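(* Let $N, d_{\mathrm{in}}, d_{\mathrm{out}}, r$ be positive integers with $r<\min\{d_{\mathrm{in}},d_{\mathrm{out}}\}$. For each $i\in\{1,\dots,N\}$ let $\Delta_i\in\mathbb{R}^{d_{\mathrm{out}}\times d_{\mathrm{in}}}$ be a matrix and let $\Sigma_i\in\mathbb{R}^{d_{\mathrm{in}}\times d_{\mathrm{in}}}$ be symmetric with $\Sigma_i\succ 0$. Define $$\mathcal{E}_A=\min_{A,\{B_i\}_{i=1}^N}\frac1N\sum_{i=1}^N\big\|(\Delta_i-B_iA)\Sigma_i^{1/2}\big\|_F^2,\qquad \mathcal{E}_B=\min_{B,\{A_i\}_{i=1}^N}\frac1N\sum_{i=1}^N\big\|(\Delta_i-BA_i)\Sigma_i^{1/2}\big\|_F^2,$$ where $A$ and all $A_i$ range over $\mathbb{R}^{r\times d_{\mathrm{in}}}$ and $B$ and all $B_i$ range over $\mathbb{R}^{d_{\mathrm{out}}\times r}$. Then minimizing the first objective over $\{B_i\}_i$ (for fixed $A$) and the second objective over $\{A_i\}_i$ (for fixed $B$) yields the following equivalent problems over the shared factors $A$ and $B$, respectively: $$\mathcal{E}_A=\min_{A\in\mathbb{R}^{r\times d_{\mathrm{in}}}}\frac1N\sum_{i=1}^N\big\|\Delta_i\Sigma_i^{1/2}(I-\Pi_{i,A})\big\|_F^2,$$ $$\mathcal{E}_B=\min_{B\in\mathbb{R}^{d_{\mathrm{out}}\times r}}\frac1N\sum_{i=1}^N\big\|(I-\Pi_B)\Delta_i\Sigma_i^{1/2}\big\|_F^2,$$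 where $$\Pi_{i,A}=(A\Sigma_i^{1/2})^\top(A\Sigma_iA^\top)^\dagger(A\Sigma_i^{1/2}),\qquad \Pi_B=B(B^\top B)^\dagger B^\top .$$
   Context: $\|\cdot\|_F$ is the Frobenius norm, $M^\dagger$ is the Moore–Penrose pseudoinverse of $M$, $\Sigma_i^{1/2}$ is the symmetric positive definite square root of $\Sigma_i$, and $I$ is the identity matrix of the appropriate size. Interpretation (not needed for the claim): $\Delta_i$ is the desired weight adaptation of client $i$, $\Sigma_i=\mathbb{E}[x_ix_i^\top]$ is the second-moment matrix of its input features $x_i\in\mathbb{R}^{d_{\mathrm{in}}}$, and $r$ is the rank of the low-rank (LoRA) update $B_iA_i$. *)

(* Defs.v *)
From HB Require Import structures.
From mathcomp Require Import all_boot all_order all_algebra.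
From mathcomp Require Import all_classical all_reals.
From mathcomp Require complex.

Set Implicit Arguments.
Unset Strict Implicit.
Unset Printing Implicit Defensive.

Import Order.TTheory GRing.Theory Num.Theory.
Local Open Scope classical_set_scope.
Local Open Scope ring_scope.

Section MatrixNotions.
Variable R : realType.

Definition frobenius_norm m n (M : 'M[R]_(m, n)) : R :=
  Num.sqrt (\sum_i \sum_j M i j ^+ 2).

(* The four Penrose equations. *)
Definition is_mpinv m n (M : 'M[R]_(m, n)) (X : 'M[R]_(n, m)) : Prop :=
  [/\ M *m X *m M = M, X *m M *m X = X,
      (M *m X)^T = M *m X & (X *m M)^T = X *m M].

(* Not MathComp's pinvmx, which is only a partial inverse on the row space;
   mpinvP and mpinv_uniq below justify the choice operator. *)
Definition mpinv m n (M : 'M[R]_(m, n)) : 'M[R]_(n, m) :=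
  xget 0 [set X | is_mpinv M X].

Definition spdmx n (S : 'M[R]_n) : Prop :=
  S^T = S /\ forall x : 'cV[R]_n, x != 0 -> 0 < (x^T *m S *m x) 0 0.

(* spd_sqrtP and spd_sqrt_uniq below justify the choice operator. *)
Definition spd_sqrt n (S : 'M[R]_n) : 'M[R]_n :=
  xget 0 [set T | spdmx T /\ T *m T = S].

Definition is_minimum (E : set R) (m : R) : Prop := E m /\ lbound E m.

Lemma mpinv_uniq m n (M : 'M[R]_(m, n)) X Y :
  is_mpinv M X -> is_mpinv M Y -> X = Y.
Proof.
move=> [X1 X2 X3 X4] [Y1 Y2 Y3 Y4].
have eMX : M *m X = M *m Y.
  rewrite -X3 -[in LHS]Y1 -[M *m Y *m M *m X]mulmxA trmx_mul X3 Y3.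
  by rewrite mulmxA X1.
have eXM : X *m M = Y *m M.
  rewrite -X4 -[in LHS]Y1 -[M *m Y *m M]mulmxA mulmxA trmx_mul X4 Y4.
  by rewrite -mulmxA (mulmxA M) X1.
by rewrite -X2 eXM -mulmxA eMX mulmxA Y2.
Qed.

Lemma dotv_ge0 n (x : 'cV[R]_n) : 0 <= (x^T *m x) 0 0.
Proof. by rewrite mxE sumr_ge0 // => i _; rewrite mxE -expr2 sqr_ge0. Qed.

Lemma dotv_eq0 n (x : 'cV[R]_n) : (x^T *m x) 0 0 = 0 -> x = 0.
Proof.
rewrite mxE => /eqP; rewrite psumr_eq0; last first.
  by move=> i _; rewrite mxE -expr2 sqr_ge0.
move=> /allP x0; apply/matrixP => i j; rewrite ord1 mxE; apply/eqP.
by have := x0 i (mem_index_enum _); rewrite mxE -expr2 sqrf_eq0.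
Qed.

Lemma gram_unit m n (M : 'M[R]_(m, n)) :
  row_full M -> M^T *m M \in unitmx.
Proof.
move=> fM; rewrite -row_free_unit -kermx_eq0; apply/rowV0P => v /sub_kermxP vMM.
have MvT0 : M *m v^T = 0.
  apply: dotv_eq0; rewrite trmx_mul trmxK mulmxA -(mulmxA v) vMM mul0mx.
  by rewrite mxE.
have : v *m M^T = 0 by rewrite -[LHS]trmxK trmx_mul trmxK MvT0 trmx0.
have /row_freeP[B MB] : row_free M^T by rewrite /row_free mxrank_tr; exact: fM.
by move=> /(congr1 (mulmx^~ B)); rewrite -mulmxA MB mulmx1 mul0mx.
Qed.

Lemma mpinv_exists m n (M : 'M[R]_(m, n)) : exists X, is_mpinv M X.
Proof.
have [k [C [W [-> fC fW]]]] : exists k (C : 'M[R]_(m, k)) (W : 'M[R]_(k, n)),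
    [/\ M = C *m W, row_full C & row_free W].
  exists (\rank M), (col_base M), (row_base M).
  by rewrite mulmx_base col_base_full row_base_free.
have uC : C^T *m C \in unitmx by exact: gram_unit.
have uW : W *m W^T \in unitmx.
  by rewrite -{1}[W]trmxK; apply: gram_unit; rewrite /row_full mxrank_tr.
set P := invmx (C^T *m C); set Q := invmx (W *m W^T).
have PT : P^T = P by rewrite /P trmx_inv trmx_mul trmxK.
have QT : Q^T = Q by rewrite /Q trmx_inv trmx_mul trmxK.
have MX : C *m W *m (W^T *m Q *m P *m C^T) = C *m P *m C^T.
  by rewrite !mulmxA -(mulmxA C W) -(mulmxA C _ Q) mulmxV // mulmx1.
have XM : (W^T *m Q *m P *m C^T) *m (C *m W) = W^T *m Q *m W.
  by rewrite !mulmxA -(mulmxA _ C^T C) -(mulmxA _ P) mulVmx // mulmx1.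
exists (W^T *m Q *m P *m C^T); split.
- by rewrite MX !mulmxA -(mulmxA _ C^T C) -(mulmxA C P) mulVmx // mulmx1.
- by rewrite XM !mulmxA -(mulmxA _ W W^T) -(mulmxA _ Q (W *m _)) mulVmx // mulmx1.
- by rewrite MX !trmx_mul trmxK PT mulmxA.
- by rewrite XM !trmx_mul trmxK QT mulmxA.
Qed.

Lemma mpinvP m n (M : 'M[R]_(m, n)) : is_mpinv M (mpinv M).
Proof. by have [X MX] := mpinv_exists M; exact: (xgetI 0 MX). Qed.

Lemma spd_sqrt_uniq n (S T U : 'M[R]_n) : spdmx T -> T *m T = S ->
  spdmx U -> U *m U = S -> T = U.
Proof.
move=> [Tsym Tpos] TT [Usym Upos] UU; set D := T - U.
have Dsym : D^T = D by rewrite /D raddfB /= Tsym Usym.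
have DTU : D *m T + U *m D = 0.
  by rewrite /D mulmxBl mulmxBr TT UU addrA subrK subrr.
have tr0 : \tr (D *m T *m D) + \tr (D *m U *m D) = 0.
  rewrite -(mulmxA D U) [\tr (D *m T *m D)]mxtrace_mulC -mxtraceD -mulmxDr.
  by rewrite DTU mulmx0 mxtrace0.
have quad (V : 'M[R]_n) i :
    (D *m V *m D) i i = ((col i D)^T *m V *m col i D) 0 0.
  rewrite tr_col Dsym -row_mul colE mulmxA -colE.
  by rewrite -row_mul !mxE.
have ge0 (V : 'M[R]_n) : spdmx V -> forall i, 0 <= (D *m V *m D) i i.
  move=> [_ Vpos] i; rewrite quad; have [->|/Vpos/ltW//] := eqVneq (col i D) 0.
  by rewrite mulmx0 mxE.
have trge0 (V : 'M[R]_n) : spdmx V -> 0 <= \tr (D *m V *m D).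
  by move=> Vp; apply: sumr_ge0 => i _; exact: ge0.
have T0 : \tr (D *m T *m D) == 0.
  have /eqP := tr0; rewrite paddr_eq0 ?trge0//.
  by case/andP.
apply/eqP; rewrite -subr_eq0 -/D; apply/eqP/matrixP => i j.
move: T0; rewrite psumr_eq0; last by move=> k _; exact: ge0.
move=> /allP/(_ j (mem_index_enum _)); rewrite /= quad => /eqP Dj0.
have [c0|/Tpos] := eqVneq (col j D) 0; last by rewrite Dj0 ltxx.
by have := congr1 (fun v : 'cV[R]_n => v i 0) c0; rewrite !mxE.
Qed.

Lemma interpolate (g : R -> R) (s : seq R) :
  exists q : {poly R}, {in s, forall x, q.[x] = g x}.
Proof.
elim: s => [|a s [q qs]]; first by exists 0.
have [as_|nas] := boolP (a \in s).
  by exists q => x; rewrite inE => /predU1P[->|]; exact: qs.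
pose w : {poly R} := \prod_(b <- s) ('X - b%:P).
have wa : w.[a] != 0 by have := root_prod_XsubC s a; rewrite /root (negbTE nas) => ->.
exists (q + ((g a - q.[a]) / w.[a]) *: w) => x; rewrite inE !hornerE.
case/predU1P => [->|xs]; first by rewrite divfK// addrC subrK.
have /rootP -> : root w x by rewrite root_prod_XsubC.
by rewrite mulr0 addr0 qs.
Qed.

Lemma trmx_horner_mx n (S : 'M[R]_n.+1) (q : {poly R}) :
  S^T = S -> (horner_mx S q)^T = horner_mx S q.
Proof.
move=> Ssym; elim/poly_ind: q => [|q c IH]; first by rewrite rmorph0 trmx0.
rewrite rmorphD rmorphM /= horner_mx_X horner_mx_C -mulmxE.
rewrite raddfD /= trmx_mul tr_scalar_mx IH Ssym; congr (_ + _).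
exact/esym/comm_horner_mx.
Qed.

Import complex.

Lemma spd_sqrt_exists n (S : 'M[R]_n) :
  spdmx S -> exists T, spdmx T /\ T *m T = S.
Proof.
case: n S => [|n] S [Ssym Spos].
  by exists S; split=> //; rewrite [LHS]flatmx0 [RHS]flatmx0.
pose f := real_complex R; pose A : 'M[R[i]]_n.+1 := map_mx f S.
have Aherm : A \is hermsymmx.
  apply: realsym_hermsym; first by apply/is_hermitianmxP; rewrite expr0 scale1r map_mx_id // [in RHS]/A map_trmx Ssym.
  by apply/mxOverP => i j; rewrite mxE; apply/complex_realP; eexists.
have Anorm := hermitian_normalmx Aherm.
have /orthomx_spectralP Adiag := Anorm.
set P := spectralmx A in Adiag; set d := spectral_diag A in Adiag.
have Pu : P \in unitmx by exact: spectral_unit.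
have dreal : d \is a mxOver Num.real := hermitian_spectral_diag_real Aherm.
clearbody P d.
pose e j : R := complex.Re (d 0 j).
have dE j : d 0 j = f (e j).
  have /mxOverP/(_ 0 j)/complex_realP[x dx] := dreal.
  by rewrite /e dx.
have e_gt0 j : 0 < e j.
  have : eigenvalue A (f (e j)).
    apply/eigenvalueP; exists (row j P).
      rewrite -row_mul {1}Adiag !mulmxA mulmxV // mul1mx row_mul row_diag_mx.
      by rewrite -scalemxAl -rowE dE.
    apply/eqP => /(congr1 (mulmx^~ (invmx P))); rewrite -row_mul mulmxV // mul0mx.
    move=> /(congr1 (fun v : 'rV_n.+1 => v 0 j)); rewrite !mxE eqxx => /eqP.
    by rewrite oner_eq0.
  rewrite eigenvalue_map => /eigenvalueP[v vS v0].
  have := Spos v^T; rewrite -(inj_eq trmx_inj) trmxK trmx0 => /(_ v0).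
  rewrite vS -scalemxAl mxE => pos.
  have := dotv_ge0 v^T; rewrite trmxK => ge0.
  rewrite ltNge; apply/negP => le0; move: pos.
  by rewrite ltNge mulr_le0_ge0.
have [q qE] := interpolate (fun x => Num.sqrt (Num.sqrt x)) [seq e j | j : 'I_n.+1].
pose Q : 'M[R]_n.+1 := horner_mx S q.
have QT : Q^T = Q by exact: trmx_horner_mx.
have Q4 : (Q *m Q) *m (Q *m Q) = S.
  have -> : (Q *m Q) *m (Q *m Q) = horner_mx S (q ^+ 4).
    by rewrite rmorphXn /= -/Q !exprS expr0 mulr1 -!mulmxE !mulmxA.
  apply: (map_mx_inj (f := f)); rewrite -/A map_horner_mx.
  have uconj p := horner_mx_uconjC p (diag_mx d) (Pu : P \is a GRing.unit).
  rewrite -/A Adiag uconj.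
  congr (_ *m _ *m _); rewrite horner_mx_diag; congr diag_mx.
  apply/rowP => j; rewrite !mxE dE horner_map /= horner_exp; congr (f _).
  rewrite qE; last by apply/mapP; exists j; rewrite ?mem_enum.
  by rewrite (exprM _ 2 2) !sqr_sqrtr ?sqrtr_ge0 // ltW.
have Qinj (x : 'cV[R]_n.+1) : Q *m x = 0 -> x = 0.
  move=> Qx; apply/eqP/negPn/negP => /Spos.
  by rewrite -Q4 -!mulmxA Qx !mulmx0 mxE ltxx.
exists (Q *m Q); split; last exact: Q4.
split=> [|x x0]; first by rewrite trmx_mul QT.
have -> : x^T *m (Q *m Q) *m x = (Q *m x)^T *m (Q *m x).
  by rewrite trmx_mul QT !mulmxA.
rewrite lt_neqAle dotv_ge0 andbT eq_sym.
by apply: contraNneq x0 => /dotv_eq0/Qinj ->.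
Qed.

Lemma spd_sqrtP n (S : 'M[R]_n) :
  spdmx S -> spdmx (spd_sqrt S) /\ spd_sqrt S *m spd_sqrt S = S.
Proof.
move=> /spd_sqrt_exists[T ST].
exact: (@xgetI _ 0 [set T : 'M[R]_n | spdmx T /\ T *m T = S] T ST).
Qed.

End MatrixNotions.

Section Objectives.
Variables (R : realType) (N din dout r : nat).
Variables (Delta : 'I_N -> 'M[R]_(dout, din)) (Sigma : 'I_N -> 'M[R]_din).

Definition err_sharedA (A : 'M[R]_(r, din)) (B : 'I_N -> 'M[R]_(dout, r)) : R :=
  N%:R^-1 * \sum_(i < N)
    frobenius_norm ((Delta i - B i *m A) *m spd_sqrt (Sigma i)) ^+ 2.

Definition err_sharedB (B : 'M[R]_(dout, r)) (A : 'I_N -> 'M[R]_(r, din)) : R :=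
  N%:R^-1 * \sum_(i < N)
    frobenius_norm ((Delta i - B *m A i) *m spd_sqrt (Sigma i)) ^+ 2.

Definition PiA (S : 'M[R]_din) (A : 'M[R]_(r, din)) : 'M[R]_din :=
  (A *m spd_sqrt S)^T *m mpinv (A *m S *m A^T) *m (A *m spd_sqrt S).

Definition PiB (B : 'M[R]_(dout, r)) : 'M[R]_dout :=
  B *m mpinv (B^T *m B) *m B^T.

Definition reduced_errA (A : 'M[R]_(r, din)) : R :=
  N%:R^-1 * \sum_(i < N)
    frobenius_norm (Delta i *m spd_sqrt (Sigma i) *m (1%:M - PiA (Sigma i) A)) ^+ 2.

Definition reduced_errB (B : 'M[R]_(dout, r)) : R :=
  N%:R^-1 * \sum_(i < N)
    frobenius_norm ((1%:M - PiB B) *m Delta i *m spd_sqrt (Sigma i)) ^+ 2.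

End Objectives.

(* Main.v *)
(** For a fixed shared factor, each inner problem is a least squares problem
    [min_B |M - B C|] with [C = A Sigma_i^(1/2)] (or its transpose); since
    [C P = C] for the orthogonal projection [P = C^T (C C^T)^+ C], one has
    [M (1 - P) = (M - B C) (1 - P)], so [|M (1 - P)|] is a lower bound, attained
    at [B = M C^T (C C^T)^+].

    The joint minimum exists because, after stacking the client factors in one
    block matrix, both objectives have the form [F (B A)] with [F] continuous and
    coercive. Any product [B A] can be refactored so that [A] has orthonormal
    rows; then [B = (B A) A^T] is bounded on sublevel sets of [F], and
    compactness applies. Joint and iterated minima coincide. *)

Require Import Defs.
From HB Require Import structures.
From mathcomp Require Import all_boot all_order all_algebra.
From mathcomp Require Import all_classical all_reals.
From mathcomp Require Import topology normedtype derive.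

Set Implicit Arguments.
Unset Strict Implicit.
Unset Printing Implicit Defensive.

Import Order.TTheory GRing.Theory Num.Theory.
Import numFieldNormedType.Exports.
Local Open Scope classical_set_scope.
Local Open Scope ring_scope.

(** * Orthogonal projections onto row spaces and least squares *)

Section Projection.
Variable R : realType.

Lemma frobenius_sqE m n (M : 'M[R]_(m, n)) :
  frobenius_norm M ^+ 2 = \sum_i \sum_j M i j ^+ 2.
Proof.
rewrite /frobenius_norm sqr_sqrtr //.
by apply: sumr_ge0 => i _; apply: sumr_ge0 => j _; exact: sqr_ge0.
Qed.

Lemma frobenius_sq_tr m n (M : 'M[R]_(m, n)) :
  frobenius_norm M ^+ 2 = \tr (M *m M^T).
Proof.
rewrite frobenius_sqE; apply: eq_bigr => i _; rewrite mxE.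
by apply: eq_bigr => j _; rewrite mxE expr2.
Qed.

Lemma frobenius_norm_trmx m n (M : 'M[R]_(m, n)) :
  frobenius_norm M^T = frobenius_norm M.
Proof.
rewrite /frobenius_norm exchange_big; congr Num.sqrt.
by apply: eq_bigr => i _; apply: eq_bigr => j _; rewrite mxE.
Qed.

(** Pythagoras: [X *m P] and [X *m (1%:M - P)] are orthogonal, so the gap between the two sides is
    the squared norm of [X *m P]. *)
Lemma frobenius_proj_le m n (X : 'M[R]_(m, n)) (P : 'M[R]_n) :
  P^T = P -> P *m P = P ->
  frobenius_norm (X *m (1%:M - P)) ^+ 2 <= frobenius_norm X ^+ 2.
Proof.
move=> PT PP; rewrite -subr_ge0.
suff -> : frobenius_norm X ^+ 2 - frobenius_norm (X *m (1%:M - P)) ^+ 2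
          = frobenius_norm (X *m P) ^+ 2 by exact: sqr_ge0.
have QQ : (1%:M - P) *m (1%:M - P) = 1%:M - P.
  by rewrite mulmxBr mulmx1 mulmxBl mul1mx PP subrr subr0.
rewrite !frobenius_sq_tr !trmx_mul (raddfB trmx) /= trmx1 PT !mulmxA.
rewrite -(mulmxA X P P) PP -(mulmxA X _ (1%:M - P)) QQ.
by rewrite mulmxBr mulmx1 mulmxBl (raddfB (@mxtrace R m)) /= subKr.
Qed.

Lemma trmx_mpinv m n (M : 'M[R]_(m, n)) : (mpinv M)^T = mpinv M^T.
Proof.
have [M1 M2 M3 M4] := mpinvP M.
apply: (mpinv_uniq _ (mpinvP M^T)); split.
- by rewrite -!trmx_mul mulmxA M1.
- by rewrite -!trmx_mul mulmxA M2.
- by rewrite -trmx_mul M4.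
- by rewrite -trmx_mul M3.
Qed.

(** Orthogonal projection onto the row space of [C], acting on the right. Both [PiA] and [PiB] are
    instances, so one least squares bound serves both objectives. *)
Definition row_proj m n (C : 'M[R]_(m, n)) : 'M[R]_n :=
  C^T *m mpinv (C *m C^T) *m C.

Lemma trmx_row_proj m n (C : 'M[R]_(m, n)) : (row_proj C)^T = row_proj C.
Proof.
by rewrite /row_proj !trmx_mul trmx_mpinv trmx_mul !trmxK mulmxA.
Qed.

Lemma row_proj_idem m n (C : 'M[R]_(m, n)) :
  row_proj C *m row_proj C = row_proj C.
Proof.
have [_ G2 _ _] := mpinvP (C *m C^T).
rewrite /row_proj -{3}G2 !mulmxA; congr (_ *m _ *m _).
Qed.

(** The first Penrose equation for [C *m C^T] only shows that the defect [D] satisfies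
    [D *m C^T = 0]. The rows of [D] lie in the row space of [C], so this forces [D *m D^T = 0] and
    hence [D = 0]. *)
Lemma mul_row_proj m n (C : 'M[R]_(m, n)) : C *m row_proj C = C.
Proof.
have [G1 _ _ _] := mpinvP (C *m C^T).
apply/esym/eqP; rewrite -subr_eq0; apply/eqP.
set D := C - _.
have DC : D *m C^T = 0.
  by rewrite /D mulmxBl /row_proj !mulmxA -(mulmxA _ C) G1 subrr.
have DD : D *m D^T = 0.
  rewrite {2}/D (raddfB trmx) /= trmx_mul trmx_row_proj mulmxBr DC.
  by rewrite /row_proj !mulmxA DC !mul0mx subrr.
have : frobenius_norm D ^+ 2 == 0 by rewrite frobenius_sq_tr DD mxtrace0.
rewrite frobenius_sqE psumr_eq0; last first.
  by move=> i _; apply: sumr_ge0 => j _; exact: sqr_ge0.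
move=> /allP D0; apply/matrixP => i j; rewrite [RHS]mxE.
have := D0 i (mem_index_enum _); rewrite /= psumr_eq0; last first.
  by move=> k _; exact: sqr_ge0.
by move=> /allP/(_ j (mem_index_enum _)); rewrite /= sqrf_eq0 => /eqP.
Qed.

Lemma row_proj_least m n p (M : 'M[R]_(p, n)) (C : 'M[R]_(m, n)) B :
  frobenius_norm (M *m (1%:M - row_proj C)) ^+ 2 <=
  frobenius_norm (M - B *m C) ^+ 2.
Proof.
suff -> : M *m (1%:M - row_proj C) = (M - B *m C) *m (1%:M - row_proj C).
  by apply: frobenius_proj_le; [exact: trmx_row_proj | exact: row_proj_idem].
by rewrite mulmxBl -mulmxA [C *m _]mulmxBr mulmx1 mul_row_proj subrr mulmx0 subr0.
Qed.

End Projection.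

(** * Factorizations with orthonormal rows *)

Section Orthonormalization.
Variable R : realType.

Lemma spdmx_unit n (S : 'M[R]_n) : spdmx S -> S \in unitmx.
Proof.
move=> [_ Spos]; rewrite -row_free_unit -kermx_eq0.
apply/rowV0P => v /sub_kermxP vS; apply/eqP/negPn/negP.
rewrite -(inj_eq trmx_inj) trmx0 => /Spos.
by rewrite trmxK vS mul0mx mxE ltxx.
Qed.

Lemma spdmx_gram m n (W : 'M[R]_(m, n)) : row_free W -> spdmx (W *m W^T).
Proof.
move=> Wfree; split=> [|x x0]; first by rewrite trmx_mul trmxK.
have -> : x^T *m (W *m W^T) *m x = (W^T *m x)^T *m (W^T *m x).
  by rewrite trmx_mul trmxK !mulmxA.
rewrite lt_neqAle dotv_ge0 andbT eq_sym.
apply: contraNneq x0 => /dotv_eq0 Wx; rewrite -(inj_eq trmx_inj) trmx0.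
by rewrite -(mulmx_free_eq0 _ Wfree) -[x^T *m W]trmxK trmx_mul trmxK Wx trmx0.
Qed.

(** [A] may be rank deficient, so its row space is first enlarged: [W] consists of the first [m]
    rows of the invertible [row_ebase A]. Multiplying [W] by the inverse square root of its Gram
    matrix then makes the rows orthonormal. *)
Lemma orthonormal_rows_factor m n (A : 'M[R]_(m, n)) : (m <= n)%N ->
  exists (L : 'M_m) (Q : 'M_(m, n)), Q *m Q^T = 1%:M /\ A = L *m Q.
Proof.
move=> mn; pose W : 'M_(m, n) := pid_mx m *m row_ebase A.
have Wfree : row_free W.
  by rewrite /row_free mxrankMfree ?row_free_unit ?row_ebase_unit //
    rank_pid_mx ?eqxx.
have AE : A = col_ebase A *m pid_mx (\rank A) *m W.
  rewrite /W mulmxA -(mulmxA (col_ebase A)) mul_pid_mx.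
  by rewrite (minn_idPl (rank_leq_row A)) (minn_idPr (rank_leq_row A)) mulmx_ebase.
clearbody W.
have [Tspd TT] := spd_sqrtP (spdmx_gram Wfree); set T := spd_sqrt _ in Tspd TT *.
have Tunit : T \in unitmx := spdmx_unit Tspd.
exists (col_ebase A *m pid_mx (\rank A) *m T), (invmx T *m W); split.
  rewrite trmx_mul trmx_inv Tspd.1 mulmxA -(mulmxA _ W) -TT !mulmxA.
  by rewrite mulVmx // mul1mx mulmxV.
by rewrite [LHS]AE [RHS]mulmxA mulmxK.
Qed.

End Orthonormalization.

(** * Continuity, coercivity and existence of low-rank minimizers *)

Section Attainment.
Variable R : realType.

(** Basic neighbourhoods of a matrix constrain its entries separately, and there are finitely many
    entries. *)
Lemma continuous_mx (T : topologicalType) m n (g : T -> 'M[R]_(m, n)) :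
  (forall i j, continuous (fun x => g x i j)) -> continuous g.
Proof.
move=> gc x A [P gP PA]; apply: filterS PA _; near=> y.
move=> i j; move: (i) (j); near: y.
by apply: filter_forall => i; apply: filter_forall => j; exact: gc.
Unshelve. all: by end_near. Qed.

Lemma continuous_entry (T : topologicalType) m n (g : T -> 'M[R]_(m, n)) i j :
  continuous g -> continuous (fun x => g x i j).
Proof.
move=> gc x.
exact: (@continuous_comp _ _ _ g (fun M : 'M[R]_(m, n) => M i j) x (gc x)
  (@coord_continuous _ _ _ i j (g x))).
Qed.

Lemma continuous_mxsub m n p q (f : 'I_p -> 'I_m) (g : 'I_q -> 'I_n) :
  continuous (fun M : 'M[R]_(m, n) => mxsub f g M).
Proof.
apply: continuous_mx => i j; under eq_fun do rewrite mxE.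
exact: coord_continuous.
Qed.

Lemma continuous_sumr (T : topologicalType) (I : Type) (s : seq I)
    (f : I -> T -> R) :
  (forall i, continuous (f i)) -> continuous (fun x => \sum_(i <- s) f i x).
Proof. by move=> fc; apply: continuous_big => //; exact: add_continuous. Qed.

Lemma continuous_mulmx (T : topologicalType) m n p
    (f : T -> 'M[R]_(m, n)) (g : T -> 'M[R]_(n, p)) :
  continuous f -> continuous g -> continuous (fun x => f x *m g x).
Proof.
move=> fc gc; apply: continuous_mx => i j.
under eq_fun do rewrite mxE.
apply: continuous_sumr => k x.
by apply: continuousM; exact: continuous_entry.
Qed.

Lemma continuous_frobenius_sq m n :
  continuous (fun M : 'M[R]_(m, n) => frobenius_norm M ^+ 2).
Proof.
under eq_fun do rewrite frobenius_sqE.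
apply: continuous_sumr => i; apply: continuous_sumr => j x.
by apply: continuousM; exact: coord_continuous.
Qed.

Lemma lowrank_min m r n (F : 'M[R]_(m, n) -> R) :
    (r <= n)%N -> continuous F ->
    (forall c, exists rho, forall X, F X <= c -> forall i j, `|X i j| <= rho) ->
  exists (B0 : 'M_(m, r)) (A0 : 'M_(r, n)),
    forall B A, F (B0 *m A0) <= F ((B : 'M_(m, r)) *m A).
Proof.
move=> rn Fcont Fcoer; have [rho rhoP] := Fcoer (F 0).
(* Factoring the zero matrix supplies some [A1] with orthonormal rows; paired with a zero left
   factor it shows that [K] is nonempty and contains a point of value [F 0]. *)
have [_ [A1 [A1o _]]] := orthonormal_rows_factor (0 : 'M[R]_(r, n)) rn.
(* One bound for both factors: 1 covers the entries of a matrix with orthonormal rows, and the other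
   summand those of [(B *m A) *m A^T]. *)
pose bd := 1 + n%:R * `|rho|.
have bd_ge0 : 0 <= bd by rewrite addr_ge0 // mulr_ge0.
(* A pair of factors is coded as one row vector, so that compactness of boxes of row vectors
   applies. *)
pose facL (x : 'rV[R]_(m * r + r * n)) : 'M_(m, r) := vec_mx (lsubmx x).
pose facR (x : 'rV[R]_(m * r + r * n)) : 'M_(r, n) := vec_mx (rsubmx x).
have facLc : continuous facL.
  apply: continuous_mx => i j; under eq_fun do rewrite !mxE.
  exact: coord_continuous.
have facRc : continuous facR.
  apply: continuous_mx => i j; under eq_fun do rewrite !mxE.
  exact: coord_continuous.
pose box := [set x : 'rV[R]_(m * r + r * n) |
  forall k, `[- bd, bd]%classic (x ord0 k)].
pose K := box `&` [set x | facR x *m (facR x)^T = 1%:M].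
have Kcompact : compact K.
  apply: compact_closedI.
    by apply: (@rV_compact _ _ (fun=> `[- bd, bd]%classic)) => _;
      exact: segment_compact.
  (* Orthonormality is split into scalar equations, each the preimage of a closed set under a
     continuous function. *)
  pose D i j := [set x | (facR x *m (facR x)^T) i j = (1%:M : 'M[R]_r) i j].
  rewrite (_ : mkset _ = \bigcap_(ij in [set: 'I_r * 'I_r]) D ij.1 ij.2);
    last first.
    apply/seteqP; split=> x /=; first by rewrite /D => + ij _ => /= ->.
    by move=> xD; apply/matrixP => i j; exact: (xD (i, j)).
  apply: closed_bigI => -[i j] _ /=.
  apply: (@preimage_closed _ _ _ [set y | y = (1%:M : 'M[R]_r) i j]);
    last exact: closed_eq.
  move=> x _; apply: continuous_entry; apply: continuous_mulmx => //.
  apply: continuous_mx => k l; under eq_fun do rewrite mxE.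
  exact: continuous_entry.
have orthoK (B : 'M_(m, r)) (A : 'M_(r, n)) : A *m A^T = 1%:M ->
    F (B *m A) <= F 0 -> K (row_mx (mxvec B) (mxvec A)).
  move=> Ao FBA; split; last by rewrite /= /facR row_mxKr mxvecK.
  have A_le1 i j : `|A i j| <= 1.
    have AA1 : (A *m A^T) i i = 1 by rewrite Ao mxE eqxx.
    rewrite -(@ler_pXn2r _ 2) ?nnegrE // expr1n real_normK ?num_real //.
    rewrite -AA1 mxE (bigD1 j) //= mxE -expr2 lerDl.
    by apply: sumr_ge0 => k _; rewrite mxE -expr2 sqr_ge0.
  have BE : B = (B *m A) *m A^T by rewrite -mulmxA Ao mulmx1.
  have Bbd i j : `|B i j| <= bd.
    rewrite BE mxE; apply: le_trans (ler_norm_sum _ _ _) _.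
    apply: (@le_trans _ _ (\sum_(k < n) `|rho|)); last first.
      by rewrite sumr_const card_ord -mulr_natl /bd lerDr.
    apply: ler_sum => k _; rewrite normrM [A^T _ _]mxE -[leRHS]mulr1.
    by apply: ler_pM => //; apply: le_trans (rhoP _ FBA i k) (ler_norm _).
  move=> k; rewrite /= in_itv /= -ler_norml.
  case: (splitP k) => k' kE.
    rewrite (_ : k = lshift _ k') ?row_mxEl; last exact: val_inj.
    by case/mxvec_indexP: k' {kE} => i j; rewrite mxvecE.
  rewrite (_ : k = rshift _ k') ?row_mxEr; last exact: val_inj.
  case/mxvec_indexP: k' {kE} => i j; rewrite mxvecE.
  by rewrite (le_trans (A_le1 i j)) // /bd lerDl mulr_ge0.
have K0 : K (row_mx (mxvec 0) (mxvec A1)).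
  by apply: orthoK => //; rewrite mul0mx.
have Gc : {within K, continuous (fun x => F (facL x *m facR x))}.
  apply: continuous_subspaceT => x; apply: continuous_comp; last exact: Fcont.
  exact: continuous_mulmx.
have [x0 _ x0min] := compact_EVT_min (ex_intro _ _ K0) Kcompact Gc.
exists (facL x0), (facR x0) => B A.
have [L [Q [Qo ->]]] := orthonormal_rows_factor A rn.
rewrite mulmxA; have [FBQ|/ltW FBQ] := leP (F (B *m L *m Q)) (F 0).
  have := x0min _ (mem_set (orthoK _ _ Qo FBQ)).
  by rewrite /facL /facR row_mxKl row_mxKr !mxvecK.
apply: le_trans FBQ; have := x0min _ (mem_set K0).
by rewrite {2}/facL {2}/facR row_mxKl row_mxKr !mxvecK mul0mx.
Qed.

(** Invertibility of [S] recovers [X] as [D - Z *m invmx S] with [Z = (D - X) *m S], whose entries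
    are bounded. The bound [1 + |c|] avoids a square root, since [|c| <= (1 + |c|)^2]. *)
Lemma frobenius_weighted_coercive m n (D : 'M[R]_(m, n)) (S : 'M[R]_n) (c : R) :
  S \in unitmx ->
  exists rho, forall X, frobenius_norm ((D - X) *m S) ^+ 2 <= c ->
    forall i j, `|X i j| <= rho.
Proof.
move=> Su; pose s p q (M : 'M[R]_(p, q)) := \sum_i \sum_j `|M i j|.
have les p q (M : 'M[R]_(p, q)) i j : `|M i j| <= s _ _ M.
  rewrite /s (bigD1 i) //= (bigD1 j) //= -addrA lerDl addr_ge0 //.
    by apply: sumr_ge0.
  by apply: sumr_ge0 => k _; apply: sumr_ge0.
exists (s _ _ D + (1 + `|c|) * (n%:R * s _ _ (invmx S))) => X Xc i j.
have XE : X = D - ((D - X) *m S) *m invmx S by rewrite mulmxK // subKr.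
move: Xc XE; set Z := (D - X) *m S => Zc ->.
have Zle k : `|Z i k| <= 1 + `|c|.
  have Zik : Z i k ^+ 2 <= `|c|.
    apply: le_trans (le_trans Zc (ler_norm c)).
    rewrite frobenius_sqE (bigD1 i) //= (bigD1 k) //= -addrA lerDl addr_ge0 //.
      by apply: sumr_ge0 => l _; exact: sqr_ge0.
    by apply: sumr_ge0 => l _; apply: sumr_ge0 => l' _; exact: sqr_ge0.
  rewrite -(@ler_pXn2r _ 2) ?nnegrE ?addr_ge0 // real_normK ?num_real //.
  apply: (le_trans Zik); rewrite sqrrD expr1n mul1r mulr2n.
  by rewrite addrC !addrA lerDr !addr_ge0 // sqr_ge0.
clearbody Z; rewrite !mxE; apply: le_trans (ler_normB _ _) _.
apply: lerD; first exact: les.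
apply: le_trans (ler_norm_sum _ _ _) _.
rewrite mulr_natl mulrnAr -[n in _ *+ n]card_ord -sumr_const.
apply: ler_sum => k _; rewrite normrM; apply: ler_pM => //; exact: les.
Qed.

End Attainment.

(** Here [blk i] reads the block of client [i] off a stacked matrix, which covers vertical and
    horizontal stacking at once. Coercivity comes from the last hypothesis: every entry of the
    stacked matrix occurs in some block. *)
Lemma weighted_lowrank_min (R : realType) (N p q m r n : nat)
    (Delta : 'I_N -> 'M[R]_(p, q)) (S : 'I_N -> 'M[R]_q)
    (blk : 'I_N -> 'M[R]_(m, n) -> 'M[R]_(p, q)) :
    (0 < N)%N -> (r <= n)%N -> (forall i, S i \in unitmx) ->
    (forall i, continuous (blk i)) ->
    (forall k l, exists i k' l', forall X : 'M_(m, n),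
      X k l = blk i X k' l') ->
  exists (B0 : 'M_(m, r)) (A0 : 'M_(r, n)), forall B A,
    N%:R^-1 * (\sum_(i < N)
       frobenius_norm ((Delta i - blk i (B0 *m A0)) *m S i) ^+ 2) <=
    N%:R^-1 * (\sum_(i < N)
       frobenius_norm ((Delta i - blk i ((B : 'M_(m, r)) *m A)) *m S i) ^+ 2).
Proof.
move=> N0 rn Su blkc blkE.
pose F X := N%:R^-1 * (\sum_(i < N)
  frobenius_norm ((Delta i - blk i X) *m S i) ^+ 2).
apply: (@lowrank_min _ _ _ _ F rn).
  pose G X := \sum_(i < N) frobenius_norm ((Delta i - blk i X) *m S i) ^+ 2.
  suff Gc : continuous G.
    by move=> X; apply: (@continuousM _ _ (fun=> N%:R^-1) G X _ (Gc X));
      exact: cst_continuous.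
  apply: continuous_sumr => i X.
  apply: (@continuous_comp _ _ _ (fun X => (Delta i - blk i X) *m S i)
    (fun M : 'M[R]_(p, q) => frobenius_norm M ^+ 2)); last first.
    exact: continuous_frobenius_sq.
  apply: continuous_mulmx; last exact: cst_continuous.
  by move=> Y; apply: continuousB; [exact: cst_continuous | exact: blkc].
move=> c.
(* The level [N%:R * c] undoes the average: each nonnegative summand is at most the whole sum. *)
have [rho rhoP] := choice (fun i =>
  frobenius_weighted_coercive (Delta i) (N%:R * c) (Su i)).
exists (\sum_i `|rho i|) => X; rewrite /F mulrC ler_pdivrMr ?ltr0n // => Xc k l.
have [i [k' [l' ->]]] := blkE k l.
apply: le_trans (_ : `|rho i| <= _); last first.
  by rewrite (bigD1 i) //= lerDl; apply: sumr_ge0.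
apply: le_trans (ler_norm _); apply: rhoP; rewrite mulrC.
apply: le_trans Xc; rewrite (bigD1 i) //= lerDl.
by apply: sumr_ge0 => j _; exact: sqr_ge0.
Qed.

(** * Inner minimization and joint attainment for the two objectives *)

Section Objectives.
Variables (R : realType) (N din dout r : nat).
Variables (Delta : 'I_N -> 'M[R]_(dout, din)) (Sigma : 'I_N -> 'M[R]_din).
Hypothesis Sigma_spd : forall i, spdmx (Sigma i).

Lemma PiA_row_proj i (A : 'M[R]_(r, din)) :
  PiA (Sigma i) A = row_proj (A *m spd_sqrt (Sigma i)).
Proof.
have [[Ssym _] SS] := spd_sqrtP (Sigma_spd i).
rewrite /PiA /row_proj; congr (_ *m mpinv _ *m _).
by rewrite -{1}SS trmx_mul Ssym !mulmxA.
Qed.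

Lemma PiB_row_proj (B : 'M[R]_(dout, r)) : PiB B = row_proj B^T.
Proof. by rewrite /PiB /row_proj trmxK. Qed.

Lemma reduced_errA_min A :
  is_minimum [set err_sharedA Delta Sigma A B |
    B in [set: 'I_N -> 'M[R]_(dout, r)]] (reduced_errA Delta Sigma A).
Proof.
split=> [|_ [B _ <-]].
  exists (fun i => Delta i *m spd_sqrt (Sigma i) *m
    (A *m spd_sqrt (Sigma i))^T *m mpinv (A *m Sigma i *m A^T)) => //.
  congr (_ * _); apply: eq_bigr => i _; congr (frobenius_norm _ ^+ 2).
  by rewrite mulmxBl mulmxBr mulmx1 /PiA !mulmxA.
apply: ler_wpM2l; first by rewrite invr_ge0 ler0n.
apply: ler_sum => i _.
rewrite PiA_row_proj [(_ - _) *m _]mulmxBl -[B i *m A *m _]mulmxA.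
exact: row_proj_least.
Qed.

Lemma reduced_errB_min B :
  is_minimum [set err_sharedB Delta Sigma B A |
    A in [set: 'I_N -> 'M[R]_(r, din)]] (reduced_errB Delta Sigma B).
Proof.
split=> [|_ [A _ <-]].
  exists (fun i => mpinv (B^T *m B) *m B^T *m Delta i) => //.
  congr (_ * _); apply: eq_bigr => i _; congr (frobenius_norm _ ^+ 2).
  by rewrite !mulmxBl mul1mx /PiB !mulmxA.
apply: ler_wpM2l; first by rewrite invr_ge0 ler0n.
apply: ler_sum => i _.
(* Transposition moves the projection to the right; the transpose of [A i *m spd_sqrt (Sigma i)]
   becomes the free left factor of [B^T]. *)
rewrite -frobenius_norm_trmx -[X in _ <= X ^+ 2]frobenius_norm_trmx.
rewrite -[_ *m Delta i *m _]mulmxA [((1%:M - _) *m _)^T]trmx_mul.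
rewrite (raddfB trmx) /= trmx1 PiB_row_proj trmx_row_proj.
rewrite mulmxBl -[B *m _ *m _]mulmxA (raddfB trmx) /= [(B *m _)^T]trmx_mul.
exact: row_proj_least.
Qed.

Hypotheses (N_gt0 : (0 < N)%N) (r_le : (r <= din)%N).

Lemma spd_sqrt_unit i : spd_sqrt (Sigma i) \in unitmx.
Proof. by apply: spdmx_unit; have [] := spd_sqrtP (Sigma_spd i). Qed.

(** Stacking the [B i] vertically puts all products [B i *m A] into one product with the right
    factor [A]. *)
Lemma err_sharedA_attained :
  exists (A0 : 'M_(r, din)) B0,
    forall (A : 'M[R]_(r, din)) (B : 'I_N -> 'M[R]_(dout, r)),
    err_sharedA Delta Sigma A0 B0 <= err_sharedA Delta Sigma A B.
Proof.
pose blk i (X : 'M[R]_(\sum_(i < N) dout, din)) := submxcol X i.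
have [||B0 [A0 min0]] := @weighted_lowrank_min _ _ _ _ _ r _ Delta
    (fun i => spd_sqrt (Sigma i)) blk N_gt0 r_le spd_sqrt_unit.
- by move=> i; exact: continuous_mxsub.
- move=> k l; exists (tagnat.sig1 k), (tagnat.sig2 k), l => X.
  by rewrite mxE tagnat.sig2K.
exists A0, (fun i => submxcol B0 i) => A B.
have := min0 (\mxcol_i B i) A; rewrite /err_sharedA.
under eq_bigr do rewrite /blk -submxcol_mul.
by under [X in _ <= _ * X]eq_bigr do rewrite /blk -submxcol_mul mxcolK.
Qed.

(** Here the [A i] are placed side by side, so the common width is [N] times [din]. *)
Lemma err_sharedB_attained :
  exists (B0 : 'M_(dout, r)) A0,
  forall (B : 'M[R]_(dout, r)) (A : 'I_N -> 'M[R]_(r, din)),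
    err_sharedB Delta Sigma B0 A0 <= err_sharedB Delta Sigma B A.
Proof.
pose blk i (X : 'M[R]_(dout, \sum_(i < N) din)) := submxrow X i.
have r_le' : (r <= \sum_(i < N) din)%N.
  by rewrite sum_nat_const card_ord (leq_trans r_le) // leq_pmull.
have [||B0 [A0 min0]] := @weighted_lowrank_min _ _ _ _ _ r _ Delta
    (fun i => spd_sqrt (Sigma i)) blk N_gt0 r_le' spd_sqrt_unit.
- by move=> i; exact: continuous_mxsub.
- move=> k l; exists (tagnat.sig1 l), k, (tagnat.sig2 l) => X.
  by rewrite mxE tagnat.sig2K.
exists B0, (fun i => submxrow A0 i) => B A.
have := min0 B (\mxrow_i A i); rewrite /err_sharedB.
under eq_bigr do rewrite /blk -mul_submxrow.
by under [X in _ <= _ * X]eq_bigr do rewrite /blk -mul_submxrow mxrowK.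
Qed.

End Objectives.

Lemma is_minimum_iterated (R : realType) (T U : Type) (f : T -> U -> R)
    (g : T -> R) t0 u0 :
    (forall t, is_minimum [set f t u | u in [set: U]] (g t)) ->
    (forall t u, f t0 u0 <= f t u) ->
  is_minimum [set f p.1 p.2 | p in [set: T * U]] (f t0 u0) /\
  is_minimum [set g t | t in [set: T]] (f t0 u0).
Proof.
move=> gmin f0; split; split.
- by exists (t0, u0).
- by move=> _ [[t u] _ <-] /=.
(* [g t0] is at most [f t0 u0] as a lower bound, and at least [f t0 u0] because it is itself a value
   of [f t0]. *)
- exists t0 => //; apply/eqP; rewrite eq_le (gmin t0).2; last by exists u0.
  by have [[u _ <-] _] := gmin t0; rewrite f0.
- by move=> _ [t _ <-]; have [[u _ <-] _] := gmin t.
Qed.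

Theorem theorem1 (R : realType) (N din dout r : nat)
    (hN : (0 < N)%N) (hdin : (0 < din)%N) (hdout : (0 < dout)%N)
    (hr : (0 < r)%N) (hrmin : (r < minn din dout)%N)
    (Delta : 'I_N -> 'M[R]_(dout, din)) (Sigma : 'I_N -> 'M[R]_din)
    (hSigma : forall i : 'I_N, spdmx (Sigma i)) :
  (forall A : 'M[R]_(r, din),
     is_minimum [set err_sharedA Delta Sigma A B | B in [set: 'I_N -> 'M[R]_(dout, r)]]
                (reduced_errA Delta Sigma A)) /\
  (forall B : 'M[R]_(dout, r),
     is_minimum [set err_sharedB Delta Sigma B A | A in [set: 'I_N -> 'M[R]_(r, din)]]
                (reduced_errB Delta Sigma B)) /\
  exists EA EB : R,
    [/\ is_minimum [set err_sharedA Delta Sigma p.1 p.2 |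
                     p in [set: 'M[R]_(r, din) * ('I_N -> 'M[R]_(dout, r))]] EA,
        is_minimum [set reduced_errA Delta Sigma A | A in [set: 'M[R]_(r, din)]] EA,
        is_minimum [set err_sharedB Delta Sigma p.1 p.2 |
                     p in [set: 'M[R]_(dout, r) * ('I_N -> 'M[R]_(r, din))]] EB &
        is_minimum [set reduced_errB Delta Sigma B | B in [set: 'M[R]_(dout, r)]] EB].
Proof.
have r_le : (r <= din)%N by rewrite ltnW // (leq_trans hrmin) // geq_minl.
have minA := reduced_errA_min Delta hSigma.
have minB := reduced_errB_min Delta Sigma.
split; first exact: minA.
split; first exact: minB.
have [A0 [B0 minA0]] := err_sharedA_attained Delta hSigma hN r_le.
have [B1 [A1 minB1]] := err_sharedB_attained Delta hSigma hN r_le.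
have [jA rA] := is_minimum_iterated (@minA r) minA0.
have [jB rB] := is_minimum_iterated (@minB r) minB1.
by exists (err_sharedA Delta Sigma A0 B0), (err_sharedB Delta Sigma B1 A1).
Qed.
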